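(* Let $(A,\leq,{}',0,1)$ be a finite orthomodular poset, $(T,R)$ a time frame and $P,F,H,G$ the tense operators constructed by $(T,R)$. Let $\bar R$ be the binary relation on $T$ defined by: $s\mathrel{\bar R}t$ if and only if for each $X\in\{P,F,H,G\}$ and each $q\in A^T$ both $(G*X)(q)(s)\leq X(q)(t)\leq(F*X)(q)(s)$ and $(H*X)(q)(t)\leq X(q)(s)\leq(P*X)(q)(t)$. Then $R\subseteq\bar R$, and for each $X,Y\in\{P,F,H,G\}$, each $q\in A^T$ and each $s\in T$ we have $(Y*X)(q)(s)\approx_i(\bar Y*X)(q)(s)$, where $i=1$ if $Y\in\{H,G\}$ and $i=2$ otherwise, and $\bar Y$ denotes the tense operator constructed by $(T,\bar R)$ corresponding to $Y$.
   Context: An orthomodular poset is a bounded poset $(A,\leq,0,1)$ with a unary operation ${}'$ that is an antitone involution and a complementation ($a\vee a'=1$, $a\wedge a'=0$), such that if $x\leq y'$ then $x\vee y$ exists, and if $x\leq y$ then $y=x\vee(y\wedge x')$. For $B\subseteq A$: $L(B)$, $U(B)$ are the sets of lower and upper bounds; $\operatorname{Max}B$, $\operatorname{Min}B$ the sets of maximal and minimal elements. A time frame is $(T,R)$ with $T\neq\emptyset$, $R\subseteq T^2$ serial (each $s$ has some $r\mathrel Rs$ and some $s\mathrel Rt$). The tense operators constructed by a time frame $(T,S)$ are defined for nonempty $B\subseteq A^T$ (a single $q\in A^T$ identified with $\{q\}$) and $s\in T$ by $P(B)(s)=\operatorname{Min}U(\{q(t)\mid q\in B,t\mathrel Ss\})$,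 $F(B)(s)=\operatorname{Min}U(\{q(t)\mid q\in B,s\mathrel St\})$, $H(B)(s)=\operatorname{Max}L(\{q(t)\mid q\in B,t\mathrel Ss\})$, $G(B)(s)=\operatorname{Max}L(\{q(t)\mid q\in B,s\mathrel St\})$, with values in $(2^A\setminus\{\emptyset\})^T$. The transformation function is $\varphi(x)=\{q\in A^T\mid q(t)\in x(t)\ \forall t\in T\}$ for $x\in(2^A\setminus\{\emptyset\})^T$, and for tense operators $Y,X$ (possibly constructed by different frames) $Y*X:=Y\circ\varphi\circ X$. For nonempty $B,C\subseteq A$: $B\leq C$ iff $b\leq c$ for all $b\in B$, $c\in C$; $B\leq_1C$ iff $\forall b\in B\,\exists c\in C: b\leq c$; $B\leq_2C$ iff $\forall c\in C\,\exists b\in B: b\leq c$; $B\approx_iC$ iff $B\leq_iC$ and $C\leq_iB$. *)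

(* Defs.v *)
From HB Require Import structures.
From mathcomp Require Import all_boot all_order.
From mathcomp Require Import boolp classical_sets.

Set Implicit Arguments.
Unset Strict Implicit.
Unset Printing Implicit Defensive.

Local Open Scope classical_set_scope.

(* Suprema and infima in a poset are partial, so they appear as relations:
   [supremums [set x; y] z] reads "x \/ y exists and equals z". *)
Record orthomodular d (A : tbPOrderType d) (compl : A -> A) : Prop :=
  Orthomodular {
  compl_antitone : forall x y, (x <= y)%O -> (compl y <= compl x)%O;
  compl_involutive : involutive compl;
  compl_join : forall x, supremums [set x; compl x] (\top%O : A);
  compl_meet : forall x, infimums [set x; compl x] (\bot%O : A);
  orthogonal_join : forall x y, (x <= compl y)%O ->
    exists z, supremums [set x; y] z;
  orthomodular_law : forall x y, (x <= y)%O ->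
    exists2 m, infimums [set y; compl x] m & supremums [set x; m] y
}.

Record time_frame (T : Type) (R : T -> T -> Prop) : Prop := TimeFrame {
  time_inhabited : inhabited T;
  serial_past : forall s, exists r, R r s;
  serial_future : forall s, exists t, R s t
}.

Section Posets.
Context {d : Order.disp_t} {A : porderType d}.
Implicit Types B C : set A.

Definition Max B : set A :=
  [set x | B x /\ forall y, B y -> (x <= y)%O -> y = x].
Definition Min B : set A :=
  [set x | B x /\ forall y, B y -> (y <= x)%O -> y = x].

Definition le_sets B C := forall b c, B b -> C c -> (b <= c)%O.
Definition le1_sets B C := forall b, B b -> exists2 c, C c & (b <= c)%O.
Definition le2_sets B C := forall c, C c -> exists2 b, B b & (b <= c)%O.
Definition approx1 B C := le1_sets B C /\ le1_sets C B.
Definition approx2 B C := le2_sets B C /\ le2_sets C B.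

End Posets.

Variant tense := TP | TF | TH | TG.

Section TenseOperators.
Context {d : Order.disp_t} {A : porderType d} {T : Type}.

(* The values are not forced to be nonempty by the type.  When A is finite and
   bounded, Min U(C) and Max L(C) are nonempty for every C, so the operators
   below do take values in nonempty sets. *)
Definition tense_operator := set (T -> A) -> T -> set A.

Definition past_values (S : T -> T -> Prop) (B : set (T -> A)) (s : T) : set A :=
  [set q t | q in B & t in [set t | S t s]].
Definition future_values (S : T -> T -> Prop) (B : set (T -> A)) (s : T) : set A :=
  [set q t | q in B & t in [set t | S s t]].

Definition tense_op (S : T -> T -> Prop) (X : tense) : tense_operator :=
  fun B s =>
  match X with
  | TP => Min (ubound (past_values S B s))
  | TF => Min (ubound (future_values S B s))
  | TH => Max (lbound (past_values S B s))
  | TG => Max (lbound (future_values S B s))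
  end.

Definition transformation (x : T -> set A) : set (T -> A) :=
  [set q | forall t, x t (q t)].

Definition star (Y X : tense_operator) : tense_operator :=
  fun B => Y (transformation (X B)).

Definition induced_rel (R : T -> T -> Prop) (s t : T) : Prop :=
  forall (X : tense) (q : T -> A),
    let op := tense_op R in
    (le_sets (star (op TG) (op X) [set q] s) (op X [set q] t) /\
     le_sets (op X [set q] t) (star (op TF) (op X) [set q] s)) /\
    (le_sets (star (op TH) (op X) [set q] t) (op X [set q] s) /\
     le_sets (op X [set q] s) (star (op TP) (op X) [set q] t)).

End TenseOperators.

Arguments tense_operator {d} A T.
Arguments induced_rel {d} A {T} R s t.

Definition tense_approx d (A : porderType d) (Y : tense) : set A -> set A -> Prop :=
  match Y with
  | TH | TG => approx1
  | TP | TF => approx2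
  end.

(* Main.v *)
Require Import Defs.
From mathcomp Require Import all_boot all_order.
From mathcomp Require Import boolp classical_sets.

Import Order.TTheory.
Local Open Scope classical_set_scope.

(** In a finite poset every nonempty set has maximal and minimal elements, so
    every value of X(q) is attained by a selection in phi(X(q)).  Hence the bounds
    defining (Y*X)(q)(s) are exactly the elements bounding X(q)(t) for all
    neighbours t of s, and R is contained in its induced relation by definition.
    Enlarging R shrinks the sets of bounds, which gives one half of the
    equivalence; for the other half, the induced relation is defined so that
    every element of (Y*X)(q)(s) still bounds X(q)(t) for all new neighbours t. *)

Lemma Max_above {d : Order.disp_t} {A : finPOrderType d} (B : set A) (x : A) :
  B x -> exists2 m, Max B m & (x <= m)%O.
Proof.
(* Strong induction on the number of elements strictly above [x]: passing to a larger element of [B]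
   lowers it, and if there is none, [x] is maximal. *)
have [n] := ubnP #|[pred y | (x < y)%O]|.
elim: n x => // n IHn x; rewrite ltnS => le_n Bx.
case: (pselect (exists2 y, B y & (x < y)%O)) => [[y By xy]|x_max].
- have [|m Bm ym] := IHn y _ By.
  + apply: leq_trans le_n; apply: proper_card; apply/properP; split.
    * by apply/fintype.subsetP => z; rewrite !inE; apply: lt_trans.
    * by exists y; rewrite !inE // ltxx.
  + by exists m => //; apply: le_trans ym; apply: ltW.
- exists x => //; split=> // y By xy; apply/eqP; apply: contrapT => /negP yx.
  by apply: x_max; exists y => //; rewrite lt_neqAle eq_sym yx.
Qed.

Lemma Min_below {d : Order.disp_t} {A : finPOrderType d} (B : set A) (x : A) :
  B x -> exists2 m, Min B m & (m <= x)%O.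
Proof. exact: (@Max_above _ (A^d)%type). Qed.

Lemma tense_op_nonempty {d : Order.disp_t} {A : finTBPOrderType d} {T : Type}
    (S : T -> T -> Prop) (X : tense) (B : set (T -> A)) (s : T) :
  tense_op S X B s !=set0.
Proof.
case: X => /=.
1,2: match goal with |- Min ?U !=set0 =>
       have [|m Um _] := @Min_below _ A U \top%O; last by exists m end.
3,4: match goal with |- Max ?L !=set0 =>
       have [|m Lm _] := @Max_above _ A L \bot%O; last by exists m end.
1,2: by move=> y _; apply: lex1.
all: by move=> y _; apply: le0x.
Qed.

(** A choice function for [x] is overridden by [c] at [t] alone. *)
Lemma transformation_through {d : Order.disp_t} {A : porderType d} {T : Type}
    (x : T -> set A) (t : T) (c : A) :
  (forall u, x u !=set0) -> x t c ->
  exists2 p, transformation x p & p t = c.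
Proof.
move=> x0 xtc; exists (fun u => if pselect (u = t) then c else projT1 (cid (x0 u))).
- by move=> u; case: pselect => [ut|_] /=; [rewrite ut|case: cid].
- by case: pselect.
Qed.

(** Were some [x u] empty, no selection would exist and every [a] would be a lower bound
    vacuously. *)
Lemma lbound_transformation {d : Order.disp_t} {A : porderType d} {T : Type}
    (x : T -> set A) (D : set T) (a : A) :
  (forall u, x u !=set0) ->
  lbound [set p t | p in transformation x & t in D] a <->
  forall t c, D t -> x t c -> (a <= c)%O.
Proof.
move=> x0; split=> [La t c Dt xtc|La _ [p xp [t Dt <-]]]; last exact: La (xp t).
have [p xp <-] := transformation_through x t c x0 xtc.
by apply: La; exists p => //; exists t.
Qed.

Lemma ubound_transformation {d : Order.disp_t} {A : porderType d} {T : Type}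
    (x : T -> set A) (D : set T) (a : A) :
  (forall u, x u !=set0) ->
  ubound [set p t | p in transformation x & t in D] a <->
  forall t c, D t -> x t c -> (c <= a)%O.
Proof. exact: (@lbound_transformation _ (A^d)%type). Qed.

(** A maximal element of either set lies in the other, hence below one of its maximal elements. *)
Lemma approx1_Max {d : Order.disp_t} {A : finPOrderType d} (B C : set A) :
  C `<=` B -> Max B `<=` C -> approx1 (Max B) (Max C).
Proof.
move=> CB BC; split=> [b /BC|c [/CB Bc _]]; first exact: Max_above.
exact: Max_above.
Qed.

Lemma approx2_Min {d : Order.disp_t} {A : finPOrderType d} (B C : set A) :
  C `<=` B -> Min B `<=` C -> approx2 (Min B) (Min C).
Proof.
move=> CB BC; split=> [c [/CB Bc _]|b /BC]; first exact: Min_below.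
exact: Min_below.
Qed.

Lemma sub_induced_rel {d : Order.disp_t} {A : finTBPOrderType d} {T : Type}
    (R : T -> T -> Prop) (s t : T) : R s t -> induced_rel A R s t.
Proof.
move=> Rst X q op; have op0 u := tense_op_nonempty R X [set q] u.
split; split=> b c.
- by move=> [/(lbound_transformation _ _ _ op0) Lb _]; apply: Lb.
- by move=> xb [/(ubound_transformation _ _ _ op0) Uc _]; apply: Uc xb.
- by move=> [/(lbound_transformation _ _ _ op0) Lb _]; apply: Lb.
- by move=> xb [/(ubound_transformation _ _ _ op0) Uc _]; apply: Uc xb.
Qed.

Theorem theorem18 (d : Order.disp_t) (A : finTBPOrderType d) (compl : A -> A)
    (T : Type) (R : T -> T -> Prop)
    (hA : orthomodular compl) (hR : time_frame R) :
  let Rbar := induced_rel A R in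
  (forall s t : T, R s t -> Rbar s t) /\
  (forall (X Y : tense) (q : T -> A) (s : T),
     tense_approx Y
       (star (tense_op R Y) (tense_op R X) [set q] s)
       (star (tense_op Rbar Y) (tense_op R X) [set q] s)).
Proof.
move=> Rbar; have RRbar s t : R s t -> Rbar s t by exact: sub_induced_rel.
split=> // X Y q s; have op0 u := tense_op_nonempty R X [set q] u.
(* [B] and [C] are the bounds over [R] and over [Rbar]; for each [Y] the first goal is the inclusion
   of [C] in [B], the second concerns the extremal elements of [B]. *)
case: Y; [apply: approx2_Min|apply: approx2_Min
         |apply: approx1_Max|apply: approx1_Max] => a.
1,3: move=> /(ubound_transformation _ _ _ op0) Ua;
     by apply/(ubound_transformation _ _ _ op0) => t c /RRbar; apply: Ua.
3,5: move=> /(lbound_transformation _ _ _ op0) La;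
     by apply/(lbound_transformation _ _ _ op0) => t c /RRbar; apply: La.
1,2: move=> Ya; apply/(ubound_transformation _ _ _ op0) => t c st xc.
3,4: move=> Ya; apply/(lbound_transformation _ _ _ op0) => t c st xc.
(* One clause of [induced_rel] for each of P, F, H, G in turn; for P and H the pair is reversed,
   [st] being [Rbar t s]. *)
- by have [_ [_]] := st X q; apply.
- by have [[_ +] _] := st X q; apply.
- by have [_ [+ _]] := st X q; apply.
- by have [[+ _] _] := st X q; apply.
Qed.
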